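(* Let $T$ be the tree with vertex set $\{1,\dots,7\}$ and edges $[1,2],[2,3],[3,4],[4,5],[3,6],[6,7]$, and let $P=\{(0,\infty),(1,4)\}$. Then the preimage $$\mathbf{data}_P=\{z\in\mathbb{R}^7:\mathrm{PH}_0(z)=P\}$$ is homotopy equivalent to $S^1$.
   Context: A vector $z\in\mathbb{R}^7$ is viewed as a function on the vertices of $T$, extended to edges by taking the maximum over the two endpoints. For $r\in\mathbb{R}$, $T_r(z)$ is the subcomplex consisting of vertices $i$ with $z_i\le r$ and edges $[i,j]$ with $\max\{z_i,z_j\}\le r$. $\mathrm{PH}_0(z)$ denotes the degree-$0$ persistence diagram (multiset of (birth, death) pairs, with death possibly $\infty$) of the sublevel-set filtration $r\mapsto T_r(z)$. $\mathbf{data}_P$ carries the subspace topology from $\mathbb{R}^7$. *)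

(* Defs.v *)
From HB Require Import structures.
From mathcomp Require Import all_boot all_order all_algebra.
From mathcomp Require Import all_classical all_reals all_analysis.
Set Implicit Arguments. Unset Strict Implicit. Unset Printing Implicit Defensive.
Import Order.TTheory GRing.Theory Num.Theory.
Import numFieldNormedType.Exports.
Local Open Scope classical_set_scope.
Local Open Scope ring_scope.

(* Vertices 1..7 of the paper are the ordinals 0..6 of 'I_7 (vertex k <-> k-1). *)
Definition treeE_dir (i j : 'I_7) : bool :=
  [|| (val i == 0%N) && (val j == 1%N), (val i == 1%N) && (val j == 2%N),
      (val i == 2%N) && (val j == 3%N), (val i == 3%N) && (val j == 4%N),
      (val i == 2%N) && (val j == 5%N) | (val i == 5%N) && (val j == 6%N)].
Definition treeE : rel 'I_7 := fun i j => treeE_dir i j || treeE_dir j i.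

Section PH.
Variable R : realType.

Definition sublevel_edge (z : 'rV[R]_7) (r : R) : rel 'I_7 :=
  fun i j => treeE i j && (Num.max (z ord0 i) (z ord0 j) <= r).

(* Rank invariant of degree-0 homology: for s <= t, the rank of
   H_0(T_s(z)) -> H_0(T_t(z)), i.e. the number of connected components of
   T_t(z) that contain a vertex of T_s(z). *)
Definition rank0 (z : 'rV[R]_7) (s t : R) : nat :=
  #|([set [set j | connect (sublevel_edge z t) i j] | i in [set i | z ord0 i <= s]])%SET|.

(* A persistence diagram: a finite multiset of (birth, death) pairs, death in R ∪ {+oo}.
   Each pair (b,d) stands for the interval [b,d) of the sublevel filtration. *)
Definition diagram := seq (R * \bar R).

(* PH_0(z) = D : the barcode of the degree-0 persistence module r |-> H_0(T_r(z))
   is D, i.e. (barcodes being determined by the rank invariant) for all s <= t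
   the rank of H_0(T_s) -> H_0(T_t) equals the number of bars [b,d) of D with
   b <= s and t < d. *)
Definition PH0_is (z : 'rV[R]_7) (D : diagram) : Prop :=
  forall s t : R, s <= t ->
    rank0 z s t = count (fun p : R * \bar R => (p.1 <= s) && (t%:E < p.2)%E) D.

Definition P_diag : diagram := [:: (0, +oo%E); (1, 4%:E)].

Definition dataP : set 'rV[R]_7 := [set z | PH0_is z P_diag].

Definition circle : set 'rV[R]_2 := [set v | v ord0 0 ^+ 2 + v ord0 1 ^+ 2 = 1].

End PH.

Definition homotopic_on {T U : topologicalType} (R : realType)
    (A : set T) (B : set U) (f g : T -> U) : Prop :=
  exists H : T * R -> U,
    {within A `*` `[0%R, 1%R], continuous H} /\
    (forall x, A x -> forall s : R, (0 <= s <= 1)%R -> B (H (x, s))) /\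
    (forall x, A x -> H (x, 0%R) = f x) /\
    (forall x, A x -> H (x, 1%R) = g x).

Definition homotopy_equivalent {T U : topologicalType} (R : realType)
    (A : set T) (B : set U) : Prop :=
  exists (f : T -> U) (g : U -> T),
    [/\ {within A, continuous f} /\ {within B, continuous g},
        (forall x, A x -> B (f x)), (forall y, B y -> A (g y)),
        homotopic_on R A A (g \o f) id & homotopic_on R B B (f \o g) id].

(* Main.v *)
(* The tree is a hub with three legs of length two. Rooting it at the hub gives
   a closed formula for the rank invariant, from which the fibre is read off: up
   to a permutation of the legs, one leg carries the minimum 0, another one the
   minimum 1 (or the hub does), the values grow outwards on what remains, and
   the two minima are separated by the value 4, taken either at the hub or at
   the near vertex of a leg. The hub value is left unchanged by a two-step
   deformation acting on each leg separately, which lowers the far vertex to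
   the near one and then moves the near vertex to the hub value, unless it is
   the separating vertex. What is left is a closed 12-gon, the configuration
   space of two labelled points (the minima) on a tripod. Giving each leg a
   weight which is positive if it carries 0, negative if it carries 1, and zero
   otherwise, embeds this polygon in R^3 / R(1,1,1) as a curve that is
   star-shaped around the origin, hence radially homeomorphic to the circle. *)

Require Import Defs.
From mathcomp Require Import all_boot all_order all_algebra.
From mathcomp Require Import all_classical all_reals all_analysis.
From mathcomp Require Import ring lra zify.
Import Order.TTheory GRing.Theory Num.Theory.
Import numFieldNormedType.Exports.
Set Implicit Arguments. Unset Strict Implicit. Unset Printing Implicit Defensive.
Local Open Scope ring_scope.

(** * The tree rooted at its hub *)

Notation vtx k := (@Ordinal 7 k isT).

Lemma forall_vtx (P : 'I_7 -> Prop) :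
  P (vtx 0) -> P (vtx 1) -> P (vtx 2) -> P (vtx 3) -> P (vtx 4) ->
  P (vtx 5) -> P (vtx 6) -> forall i, P i.
Proof.
move=> P0 P1 P2 P3 P4 P5 P6 [[|[|[|[|[|[|[|m]]]]]]] Hm] //;
  by rewrite (bool_irrelevance Hm isT).
Qed.

Lemma big_vtx (T : Type) (idx : T) (op : Monoid.law idx) (F : 'I_7 -> T) :
  \big[op/idx]_i F i = op (F (vtx 0)) (op (F (vtx 1)) (op (F (vtx 2))
    (op (F (vtx 3)) (op (F (vtx 4)) (op (F (vtx 5)) (F (vtx 6))))))).
Proof.
rewrite !big_ord_recl big_ord0 Monoid.mulm1.
by do ![congr (op _ _)]; congr (F _); apply/val_inj.
Qed.

Lemma exists_vtx (P : pred 'I_7) :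
  [exists i, P i] = [|| P (vtx 0), P (vtx 1), P (vtx 2), P (vtx 3), P (vtx 4),
                        P (vtx 5) | P (vtx 6)].
Proof. by rewrite -[LHS](big_orE xpredT P) big_vtx. Qed.

(* The tree is rooted at its hub, which is its own parent. *)
Definition parent (i : 'I_7) : 'I_7 :=
  match val i with
  | 0 => vtx 1 | 4 => vtx 3 | 6 => vtx 5 | _ => vtx 2
  end.

Lemma parent_parent i : parent (parent i) = vtx 2.
Proof. by elim/forall_vtx: i. Qed.

(** The clause [i != j] discards the loop at the hub, which is its own parent. *)
Lemma treeE_parent i j : treeE i j = (i != j) && ((parent i == j) || (parent j == i)).
Proof.
by move: i j; do 2![apply: forall_vtx].
Qed.

(* The vertex closest to the hub in the component of [i] in the forest
   spanned by [T]. *)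
Definition top_vtx (T : pred 'I_7) (i : 'I_7) : 'I_7 :=
  if T (parent i) then if T (vtx 2) then vtx 2 else parent i else i.

Lemma top_vtx_parent (T : pred 'I_7) i :
  T (parent i) -> top_vtx T (parent i) = top_vtx T i.
Proof. by rewrite /top_vtx parent_parent => ->; case: (T (vtx 2)). Qed.

(** * Components of the sublevel forests, represented by their top vertices *)

Section Rank.
Variables (R : realType) (z : 'rV[R]_7) (t : R).

Let T : pred 'I_7 := fun i => z ord0 i <= t.
Let e := sublevel_edge z t.

Lemma sublevel_edgeE i j : e i j = [&& treeE i j, T i & T j].
Proof. by rewrite /e /sublevel_edge ge_max. Qed.

Lemma sublevel_connect_sym : connect_sym e.
Proof.
apply: sym_connect_sym => i j.
by rewrite !sublevel_edgeE [T j && _]andbC /treeE orbC.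
Qed.

Lemma sublevel_edge_top i j : e i j -> top_vtx T i = top_vtx T j.
Proof.
rewrite sublevel_edgeE treeE_parent => /and3P[/andP[_ /orP[]/eqP <-] Ti Tj];
  by rewrite top_vtx_parent.
Qed.

Lemma connect_parent i : T i -> T (parent i) -> connect e i (parent i).
Proof.
move=> Ti Tp; have [<-|ne] := eqVneq i (parent i); first exact: connect0.
by apply: connect1; rewrite sublevel_edgeE treeE_parent ne eqxx /= Ti.
Qed.

Lemma connect_top i : T i -> connect e i (top_vtx T i).
Proof.
move=> Ti; rewrite /top_vtx; case: ifP => // Tp.
case: ifP => Tc; last exact: connect_parent.
apply: connect_trans (connect_parent Ti Tp) _.
by rewrite -[X in connect _ _ X](parent_parent i) connect_parent ?parent_parent.
Qed.

(** The top vertex is constant along each edge. Together with [connect_top], this makes it a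
    complete invariant of the components. *)
Lemma connect_top_eq i j : connect e i j -> top_vtx T i = top_vtx T j.
Proof.
case/connectP => p + -> {j}; elim: p i => //= j p IH i /andP[eij /IH <-].
exact: sublevel_edge_top.
Qed.

(** Each component has exactly one top vertex, so components that meet the sublevel set at [s] can
    be counted by their tops. *)
Lemma rank0_top s : s <= t ->
  rank0 z s t = #|[set top_vtx T i | i in [set i | z ord0 i <= s]%SET]%SET|.
Proof.
move=> st; rewrite /rank0; set S := [set i | _]%SET.
have ST i : i \in S -> T i by rewrite inE => /le_trans; apply.
pose C i := [set j | connect e i j]%SET.
have CE i : T i -> C i = C (top_vtx T i).
  move=> Ti; apply/setP => j; rewrite !inE.
  exact: (same_connect sublevel_connect_sym (connect_top Ti)).
have topK i : T i -> top_vtx T (top_vtx T i) = top_vtx T i.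
  by move=> Ti; apply/esym/connect_top_eq/connect_top.
transitivity #|[set C j | j in [set top_vtx T i | i in S]]%SET|.
  rewrite -imset_comp; congr #|pred_of_set _|.
  by apply: eq_in_imset => i /ST /CE.
apply: card_in_imset => _ _ /imsetP[i iS ->] /imsetP[j jS ->] /setP.
move=> /(_ (top_vtx T j)); rewrite !inE connect0 => /connect_top_eq.
by rewrite !topK ?ST.
Qed.

End Rank.

(** * The rank invariant in terms of the hub and the three legs *)

Section RankFormula.
Variable R : realType.
Implicit Types (l : R * R) (s t c : R).

(* A leg is the pair of the values at its near and far vertices. *)
Definition leg_out l s t := (l.2 <= s) && ~~ (l.1 <= t).
Definition leg_in l s t := (l.1 <= s) || (l.2 <= s) && (l.1 <= t).

(** The summands sort the top vertices by position: far vertices cut off from their near vertex,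
    then near vertices as long as the hub is above [t], then the hub. *)
Definition legs_rank c l1 l2 l3 s t : nat :=
  (leg_out l1 s t + leg_out l2 s t + leg_out l3 s t +
   [&& ~~ (c <= t)%R & leg_in l1 s t] + [&& ~~ (c <= t)%R & leg_in l2 s t] +
   [&& ~~ (c <= t)%R & leg_in l3 s t] +
   ((c <= s)%R || (c <= t)%R && [|| leg_in l1 s t, leg_in l2 s t | leg_in l3 s t]))%N.

Definition hub (z : 'rV[R]_7) : R := z ord0 (vtx 2).
Definition leg1 (z : 'rV[R]_7) : R * R := (z ord0 (vtx 1), z ord0 (vtx 0)).
Definition leg2 (z : 'rV[R]_7) : R * R := (z ord0 (vtx 3), z ord0 (vtx 4)).
Definition leg3 (z : 'rV[R]_7) : R * R := (z ord0 (vtx 5), z ord0 (vtx 6)).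

Lemma rank0_legs (z : 'rV[R]_7) s t : s <= t ->
  rank0 z s t = legs_rank (hub z) (leg1 z) (leg2 z) (leg3 z) s t.
Proof.
move=> st; rewrite rank0_top // -sum1_card big_mkcond /=.
under eq_bigr => v _.
  have -> : (v \in [set top_vtx (fun i => z ord0 i <= t) i
      | i in [set i | z ord0 i <= s]%SET]%SET)
    = [exists i, (z ord0 i <= s) && (top_vtx (fun i => z ord0 i <= t) i == v)].
    apply/imsetP/existsP => -[i]; first by rewrite inE => zi ->; exists i; rewrite zi eqxx.
    by case/andP=> zi /eqP <-; exists i; rewrite ?inE.
  rewrite exists_vtx; over.
rewrite big_vtx /top_vtx /parent /=.
rewrite /legs_rank /leg_out /leg_in /hub /leg1 /leg2 /leg3 /=.
have H i : z ord0 i <= s -> z ord0 i <= t by move=> /le_trans; apply.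
(* Both sides are now Boolean expressions in comparisons with [s] and [t]; the inconsistent case at
   the hub is removed, and a finite check remains. *)
move: (H (vtx 2)).
case: (z ord0 (vtx 2) <= s); case: (z ord0 (vtx 2) <= t) => //=; try by move=> /(_ isT).
all: move=> _.
all: case: (z ord0 (vtx 1) <= t); case: (z ord0 (vtx 3) <= t); case: (z ord0 (vtx 5) <= t) => /=.
all: case: (z ord0 (vtx 0) <= s); case: (z ord0 (vtx 1) <= s) => //=.
all: case: (z ord0 (vtx 3) <= s); case: (z ord0 (vtx 4) <= s) => //=.
all: case: (z ord0 (vtx 5) <= s); case: (z ord0 (vtx 6) <= s) => //=.
Qed.
End RankFormula.

(* [lia] does not see comparisons in [R] as opaque booleans. *)
Ltac b2n_lia :=
  repeat match goal with |- context [nat_of_bool ?b] => move: (nat_of_bool b) end;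
  clear; lia.

(** * Statements up to a permutation of the legs *)

Section Sym3.
Variable X : Type.

Definition sym3 (Q : X -> X -> X -> Prop) x y z :=
  Q x y z \/ Q x z y \/ Q y x z \/ Q y z x \/ Q z x y \/ Q z y x.

Lemma sym3_swap12 Q x y z : sym3 Q y x z -> sym3 Q x y z.
Proof. rewrite /sym3; tauto. Qed.

Lemma sym3_swap23 Q x y z : sym3 Q x z y -> sym3 Q x y z.
Proof. rewrite /sym3; tauto. Qed.

(** The two adjacent transpositions generate all six permutations. *)
Lemma sym3_elim (P Q : X -> X -> X -> Prop) x y z :
  (forall x y z, P x y z -> P y x z) -> (forall x y z, P x y z -> P x z y) ->
  (forall x y z, Q x y z -> P x y z) -> sym3 Q x y z -> P x y z.
Proof.
move=> P12 P23 QP.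
case=> [|[|[|[|[|]]]]] /QP => [//|/P23//|/P12//|/P23 /P12//|/P12 /P23//|].
by move=> /P12 /P23 /P12.
Qed.

End Sym3.

Lemma sym3_map (X Y : Type) (h : X -> Y) (P : X -> X -> X -> Prop)
    (Q : Y -> Y -> Y -> Prop) x y z :
  (forall x y z, P x y z -> Q (h x) (h y) (h z)) ->
  sym3 P x y z -> sym3 Q (h x) (h y) (h z).
Proof.
move=> PQ; case=> [|[|[|[|[|]]]]] /PQ; rewrite /sym3; tauto.
Qed.

(** A symmetric hypothesis [P] allows the triple to be sorted by the key [k] first. *)
Lemma sorted_sym3 (X : Type) (R : realType) (P Q : X -> X -> X -> Prop)
    (k : X -> R) x y z :
  (forall x y z, P x y z -> P y x z) -> (forall x y z, P x y z -> P x z y) ->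
  (forall x y z, P x y z -> k x <= k y -> k y <= k z -> sym3 Q x y z) ->
  P x y z -> sym3 Q x y z.
Proof.
move=> P12 P23 H p.
have [k12|/ltW k12] := leP (k x) (k y); have [k23|/ltW k23] := leP (k y) (k z).
- exact: H.
- have [k13|/ltW k13] := leP (k x) (k z).
    by apply/sym3_swap23/H => //; apply: P23.
  by apply/sym3_swap23/sym3_swap12/H => //; apply/P12/P23.
- have [k13|/ltW k13] := leP (k x) (k z).
    by apply/sym3_swap12/H => //; apply: P12.
  by apply/sym3_swap12/sym3_swap23/H => //; apply/P23/P12.
- by apply/sym3_swap12/sym3_swap23/sym3_swap12/H => //; apply/P12/P23/P12.
Qed.

(** * The shapes of the values with barcode [0,oo), [1,4) *)

Section Bimodal.
Variable R : realType.
Implicit Types (l : R * R) (s t c m : R).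

Definition leg_min l := Num.min l.1 l.2.

(** The minimum of a regular leg lies in the hub component once the hub is present. A walled leg
    hides a minimum [m] behind the value 4. A free leg grows outwards from the hub and gives birth
    to no class of its own. *)
Definition regular_leg m c l := leg_min l = m /\ l.1 <= c.
Definition walled_leg m l := l = (4, m).
Definition free_leg c l := c <= l.1 /\ l.1 <= l.2.

(** The wall of height 4 is the hub ([Bimodal_split]) or the near vertex of a leg. In the latter
    case [b] is the minimum on the hub side of the wall, carried by another leg ([Bimodal_side]) or
    by the hub ([Bimodal_mid]). *)
Inductive bimodal c l1 l2 l3 : Prop :=
| Bimodal_split of c = 4 & regular_leg 0 c l1 & regular_leg 1 c l2 & free_leg c l3
| Bimodal_side (b : bool) of b%:R <= c & c <= 4 &
    walled_leg (~~ b)%:R l1 & regular_leg b%:R c l2 & free_leg c l3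
| Bimodal_mid (b : bool) of c = b%:R & walled_leg (~~ b)%:R l1 &
    free_leg c l2 & free_leg c l3.

(** The near and far vertices are joined as soon as both are present, so a leg alone never has two
    components. *)
Lemma leg_out_in l s t : s <= t ->
  (leg_out l s t + leg_in l s t)%N = (leg_min l <= s).
Proof.
rewrite /leg_out /leg_in /leg_min ge_min => st.
have : l.1 <= s -> l.1 <= t by move=> /le_trans; apply.
by case: (l.1 <= s); case: (l.2 <= s); case: (l.1 <= t) => //= /(_ isT).
Qed.

(** Without the hub the legs are pairwise disconnected, and each counts once if its minimum has
    appeared. *)
Lemma legs_rank_lt c l1 l2 l3 s t : s <= t -> t < c ->
  legs_rank c l1 l2 l3 s t =
    ((leg_min l1 <= s)%R + (leg_min l2 <= s)%R + (leg_min l3 <= s)%R)%N.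
Proof.
move=> st tc; have sc := le_lt_trans st tc.
rewrite /legs_rank -!(leg_out_in _ st) !(leNgt c) tc sc /=; lia.
Qed.

Lemma legs_rank_ge c l1 l2 l3 s t : c <= t ->
  legs_rank c l1 l2 l3 s t =
    (leg_out l1 s t + leg_out l2 s t + leg_out l3 s t +
     [|| (c <= s)%R, leg_in l1 s t, leg_in l2 s t | leg_in l3 s t])%N.
Proof. by move=> ct; rewrite /legs_rank ct /= !addn0. Qed.

Definition PH_legs c l1 l2 l3 := forall s t, s <= t ->
  legs_rank c l1 l2 l3 s t = ((0 <= s)%R + ((1 <= s)%R && (t < 4)%R))%N.

Lemma dataP_legs (z : 'rV[R]_7) :
  dataP z <-> PH_legs (hub z) (leg1 z) (leg2 z) (leg3 z).
Proof.
have E s t : count (fun p : R * \bar R => (p.1 <= s) && (t%:E < p.2)%E) (P_diag R) =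
    ((0 <= s)%R + ((1 <= s)%R && (t < 4)%R))%N.
  by rewrite /= ltry lte_fin andbT addn0.
by split=> H s t st; have := H s t st; rewrite E rank0_legs.
Qed.

Lemma legs_rank_swap12 c l1 l2 l3 s t :
  legs_rank c l1 l2 l3 s t = legs_rank c l2 l1 l3 s t.
Proof.
rewrite /legs_rank orbCA; lia.
Qed.

Lemma legs_rank_swap23 c l1 l2 l3 s t :
  legs_rank c l1 l2 l3 s t = legs_rank c l1 l3 l2 s t.
Proof.
rewrite /legs_rank [leg_in l2 s t || _]orbC; lia.
Qed.

Lemma PH_legs_swap12 c l1 l2 l3 : PH_legs c l1 l2 l3 -> PH_legs c l2 l1 l3.
Proof. by move=> H s t /H; rewrite legs_rank_swap12. Qed.

Lemma PH_legs_swap23 c l1 l2 l3 : PH_legs c l1 l2 l3 -> PH_legs c l1 l3 l2.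
Proof. by move=> H s t /H; rewrite legs_rank_swap23. Qed.

Lemma walled_min m l : m <= 4 -> walled_leg m l -> leg_min l = m.
Proof. by move=> m4 ->; apply/min_r. Qed.

Lemma walled_out m l s t : walled_leg m l -> leg_out l s t = (m <= s) && (t < 4).
Proof. by move=> ->; rewrite /leg_out /= ltNge. Qed.

Lemma walled_in m l s t : m <= 4 -> s <= t -> walled_leg m l ->
  leg_in l s t = (m <= s) && (4 <= t).
Proof.
move=> m4 st ->; rewrite /leg_in /=; case: (leP 4 s) => //= s4.
by rewrite (le_trans m4 s4) (le_trans s4 st).
Qed.

Lemma regular_out m c l s t : c <= t -> regular_leg m c l -> leg_out l s t = false.
Proof. by move=> ct [_ ac]; rewrite /leg_out (le_trans ac ct) andbF. Qed.

Lemma regular_in m c l s t : c <= t -> regular_leg m c l -> leg_in l s t = (m <= s).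
Proof.
by move=> ct [<- ac]; rewrite /leg_in /leg_min ge_min (le_trans ac ct) andbT.
Qed.

Lemma free_out c l s t : s <= t -> free_leg c l -> leg_out l s t = false.
Proof.
move=> st [_ ab]; rewrite /leg_out; apply/negP => /andP[bs /negP]; apply.
exact: le_trans ab (le_trans bs st).
Qed.

Lemma free_min c l s : s < c -> free_leg c l -> (leg_min l <= s) = false.
Proof.
move=> sc [ca ab]; rewrite /leg_min (min_l ab).
by apply/negbTE; rewrite -ltNge (lt_le_trans sc ca).
Qed.

Lemma free_in c l s t : free_leg c l -> leg_in l s t -> c <= s.
Proof. by move=> [ca ab] /orP[|/andP[+ _]]; lra. Qed.

(** For [t < c] the minima of the legs are counted; for [c <= t] the cut-off far vertices and the
    hub component are. *)
Lemma bimodal_PH_legs c l1 l2 l3 : bimodal c l1 l2 l3 -> PH_legs c l1 l2 l3.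
Proof.
have b4 (b : bool) : (~~ b)%:R <= 4 :> R by case: b => /=; lra.
case=> [-> r1 r2 f3|b bc c4 i1 r2 f3|b cE i1 f2 f3] s t st.
- have [t4|t4] := ltP t 4.
    rewrite legs_rank_lt // (free_min _ f3) ?(le_lt_trans st) //.
    by rewrite (proj1 r1) (proj1 r2) addn0 andbT.
  rewrite legs_rank_ge // (regular_out _ t4 r1) (regular_out _ t4 r2).
  rewrite (free_out st f3) (regular_in _ t4 r1) (regular_in _ t4 r2) /=.
  rewrite andbF !addn0 !add0n; congr nat_of_bool; apply/idP/idP => [|->].
    by case/or4P => [||| /(free_in f3)]; lra.
  by rewrite orbT.
- have [tc|ct] := ltP t c.
    rewrite legs_rank_lt // (free_min _ f3) ?(le_lt_trans st) //.
    rewrite (walled_min _ i1) // (proj1 r2) addn0 (lt_le_trans tc c4) andbT.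
    by case: {+}b => //=; rewrite addnC.
  rewrite legs_rank_ge // (walled_out _ _ i1) (regular_out _ ct r2).
  rewrite (free_out st f3) (walled_in _ st i1) // (regular_in _ ct r2) !addn0.
  (* As [b <= c] and the free leg lies above [c], the first value to appear in the hub component is
     [b]. *)
  have cb : [|| c <= s, b%:R <= s | leg_in l3 s t] = (b%:R <= s).
    apply/idP/idP => [/or3P[|//|/(free_in f3)]|->]; rewrite ?orbT //; lra.
  rewrite orbCA cb.
  case: {+}b; have [t4|t4] := ltP t 4; have [s0|s0] := leP 0 s;
    have [s1|s1] := leP 1 s => //=; exfalso; lra.
- have bc : b%:R <= 4 :> R by case: {+}b => /=; lra.
  have [tc|ct] := ltP t c.
    rewrite legs_rank_lt // (free_min _ f3) ?(free_min _ f2) ?(le_lt_trans st) //.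
    rewrite (walled_min _ i1) // !addn0.
    move: tc; rewrite cE; case: {+}b => /= tc; have [s0|s0] := leP 0 s;
    have [s1|s1] := leP 1 s => //=; exfalso; lra.
  rewrite legs_rank_ge // (walled_out _ _ i1) (free_out st f2).
  rewrite (free_out st f3) (walled_in _ st i1) // !addn0.
  have cb : [|| c <= s, leg_in l2 s t | leg_in l3 s t] = (b%:R <= s).
    rewrite -cE; apply/idP/idP => [/or3P[//|/(free_in f2)//|/(free_in f3)//]|->//].
  rewrite orbCA cb.
  case: {+}b; have [t4|t4] := ltP t 4; have [s0|s0] := leP 0 s;
    have [s1|s1] := leP 1 s => //=; exfalso; lra.
Qed.

(** * Reading the shape of the values off the rank invariant *)

Lemma leq_b2n (b b' : bool) : (b -> b') -> (b <= b')%N.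
Proof. by case: b; case: b' => // /(_ isT). Qed.

Lemma not_leg_out l t : l.2 <= t -> leg_out l t t = false -> l.1 <= t.
Proof. by rewrite /leg_out => -> /= /negbFE. Qed.

Lemma leg_out_sub l s s' t t' :
  s <= s' -> t' <= t -> leg_out l s t -> leg_out l s' t'.
Proof.
move=> ss' tt' /andP[bs /negP at_]; apply/andP; split; first exact: le_trans ss'.
by apply/negP => h; apply: at_; apply: le_trans tt'.
Qed.

(** The hypothesis is used at the first time from [u] on at which the far vertex is present. *)
Lemma not_leg_out_ge u l : (forall t, u <= t -> leg_out l t t = false) ->
  l.1 <= Num.max u l.2.
Proof.
by move=> H; apply: not_leg_out; [rewrite le_max lexx orbT|apply: H; rewrite le_max lexx].
Qed.

Section FromPH.
Variables (c : R) (l1 l2 l3 : R * R).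
Hypothesis H : PH_legs c l1 l2 l3.

(** With the hub above 4, the rank at a time up to 4 would be the number of leg minima reached,
    which cannot drop from 2 at time 1 to 1 at time 4. *)
Lemma PH_hub_le4 : c <= 4.
Proof.
rewrite leNgt; apply/negP => c4.
have := H (lexx 4); rewrite legs_rank_lt // ltxx andbF.
have := H (lexx 1); rewrite legs_rank_lt //; last lra.
have -> : (0 <= 4 :> R) by lra.
have -> : (0 <= 1 :> R) by lra.
have -> : (1 < 4 :> R) by lra.
rewrite lexx /=.
have L l : ((leg_min l <= 1)%R <= (leg_min l <= 4)%R)%N.
  by apply: leq_b2n; lra.
have := L l1; have := L l2; have := L l3; b2n_lia.
Qed.

(** From time 4 on there is one component, and it contains the hub. *)
Lemma PH_out_ge4 t : 4 <= t ->
  [/\ leg_out l1 t t = false, leg_out l2 t t = false & leg_out l3 t t = false].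
Proof.
move=> t4; have ct : c <= t := le_trans PH_hub_le4 t4.
have := H (lexx t); rewrite legs_rank_ge // ct /= [t < 4]ltNge t4 andbF.
have -> : 0 <= t by lra.
by case: (leg_out l1 t t); case: (leg_out l2 t t); case: (leg_out l3 t t).
Qed.

End FromPH.

(** Below 4 the rank counts leg minima. Sorted, they are therefore 0, 1 and some value at least
    4. *)
Lemma PH_legs_split l1 l2 l3 : PH_legs 4 l1 l2 l3 -> sym3 (bimodal 4) l1 l2 l3.
Proof.
apply: (sorted_sym3 (k := leg_min)); [exact: PH_legs_swap12|exact: PH_legs_swap23|].
move=> {l1 l2 l3} l1 l2 l3 H m12 m23; left.
have O l : (forall t, 4 <= t -> leg_out l t t = false) -> l.1 <= Num.max 4 l.2.
  exact: not_leg_out_ge.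
have O4 := PH_out_ge4 H.
have := O l1 ltac:(by move=> t /O4[]).
have := O l2 ltac:(by move=> t /O4[]).
have := O l3 ltac:(by move=> t /O4[]).
have {}H s : s < 4 -> ((leg_min l1 <= s)%R + (leg_min l2 <= s)%R
    + (leg_min l3 <= s)%R = (0 <= s)%R + (1 <= s)%R)%N.
  by move=> s4; rewrite -(@legs_rank_lt 4 _ _ _ s s) // H // s4 andbT.
have [m1 m2 m3] : [/\ leg_min l1 = 0, leg_min l2 = 1 & 4 <= leg_min l3].
  move: (leg_min l1) (leg_min l2) (leg_min l3) m12 m23 H => x y z xy yz H.
  (* The prescribed rank is 0, 1 or 2 and says how many of the sorted minima are at most [s]. *)
  have K s : s < 4 -> [\/ [/\ s < x & s < 0], [/\ x <= s, s < y & 0 <= s < 1] |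
                          [/\ y <= s, s < z & 1 <= s]].
    move=> /H; have [s0|s0] := leP 0 s; have [s1|s1] := leP 1 s;
    have [xs|xs] := leP x s; have [ys|ys] := leP y s; have [zs|zs] := leP z s => //= _;
    solve [exfalso; lra | by constructor 1 | by constructor 2 | by constructor 3].
  have x0 : x = 0.
    have := K 0 ltac:(lra); case=> [[]|[xl yg _]|[]]; try lra.
    have := K x ltac:(lra); case=> [[]|[]|[]]; lra.
  have y1 : y = 1.
    have := K 1 ltac:(lra); case=> [[]|[]|[yl zg _]]; try lra.
    have := K y ltac:(lra); case=> [[]|[]|[]]; lra.
  split=> //; rewrite leNgt; apply/negP => /K; case=> [[]|[]|[]]; lra.
rewrite /leg_min in m1 m2 m3 *.
move=> a3 a2 a1; apply: Bimodal_split => //.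
- split=> //; move: m1 a1; case: (leP l1.1 l1.2); case: (leP 4 l1.2); lra.
- split=> //; move: m2 a2; case: (leP l2.1 l2.2); case: (leP 4 l2.2); lra.
- move: m3 a3; rewrite /free_leg le_min => /andP[]; case: (leP 4 l3.2) => ? ? ? ?; split; lra.
Qed.

(* The rank invariant of the subtree spanned by the hub and two legs. *)
Definition rest_rank c l2 l3 s t : nat :=
  if c <= t then
    (leg_out l2 s t + leg_out l3 s t + [|| (c <= s)%R, leg_in l2 s t | leg_in l3 s t])%N
  else ((leg_min l2 <= s)%R + (leg_min l3 <= s)%R)%N.

(** A single class, born at [m], is present below 4, so the values grow away from one minimum, which
    sits at the hub or on one of the two legs. *)
Lemma unimodal_rest m c l2 l3 : m < 4 -> c < 4 ->
  (forall t, 4 <= t -> leg_out l2 t t = false) ->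
  (forall t, 4 <= t -> leg_out l3 t t = false) ->
  (forall s t, s <= t -> t < 4 -> rest_rank c l2 l3 s t = (m <= s)) ->
  [\/ [/\ c = m, free_leg c l2 & free_leg c l3],
      [/\ m <= c, regular_leg m c l2 & free_leg c l3] |
      [/\ m <= c, regular_leg m c l3 & free_leg c l2]].
Proof.
move=> m4 c4 O2 O3 H.
have mc : m <= c.
  have := H c c (lexx _) c4; rewrite /rest_rank lexx /=.
  by case: (m <= c) => //; case: (leg_out _ _ _); case: (leg_out _ _ _).
(* Once present, the hub accounts for the only class, so no far vertex can be cut off. *)
have O t : c <= t -> leg_out l2 t t = false /\ leg_out l3 t t = false.
  move=> ct; have [t4|t4] := leP 4 t; first by rewrite O2 ?O3.
  have := H t t (lexx _) t4; rewrite /rest_rank ct /= (le_trans mc ct).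
  by case: (leg_out _ _ _); case: (leg_out _ _ _).
have F l : c <= leg_min l -> (forall t, c <= t -> leg_out l t t = false) -> free_leg c l.
  rewrite /leg_min le_min => /andP[ca cb] o; split => //.
  by apply: not_leg_out; rewrite ?o.
have K t : t < c -> ((leg_min l2 <= t)%R + (leg_min l3 <= t)%R = (m <= t)%R)%N.
  move=> tc; have := H t t (lexx _) (lt_trans tc c4).
  by rewrite /rest_rank leNgt tc.
have [cm|cm] := eqVneq c m.
  have G l : (leg_min l2 = leg_min l \/ leg_min l3 = leg_min l) -> c <= leg_min l.
    move=> E; rewrite leNgt; apply/negP => /[dup] lc /K; rewrite -cm (leNgt c) lc /=.
    by case: E => ->; rewrite lexx ?addn1.
  by constructor 1; split=> //; apply: F => [|t /O[]//]; apply: G; [left|right].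
have {cm} mc' : m < c by rewrite lt_neqAle eq_sym cm.
(* Here the minimum is below the hub value: [l] is the leg that carries it, and [l'] is the other
   one. *)
have reg l l' : leg_min l <= m -> m < leg_min l' ->
    (forall t, t < c -> ((leg_min l <= t)%R + (leg_min l' <= t)%R = (m <= t)%R)%N) ->
    (forall t, c <= t -> leg_out l t t = false /\ leg_out l' t t = false) ->
    [/\ m <= c, regular_leg m c l & free_leg c l'].
  move=> lm ml' K' O'.
  have lE : leg_min l = m.
    apply/eqP; rewrite eq_le lm /= leNgt; apply/negP => lm'.
    have := K' (leg_min l) (lt_trans lm' mc').
    by rewrite lexx [m <= _]leNgt lm'.
  split=> //; last first.
    apply: F => [|t /O'[]//]; rewrite leNgt; apply/negP => /[dup] l'c /K'.
    by rewrite lexx lE (ltW ml').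
  split=> //; rewrite leNgt; apply/negP => ca.
  have bc : l.2 <= c by move: lE; rewrite /leg_min; case: (leP l.1 l.2); lra.
  by have := not_leg_out bc (O' c (lexx c)).1; rewrite leNgt ca.
have := K m mc'; rewrite lexx.
have [m2|m2] := leP (leg_min l2) m; have [m3|m3] := leP (leg_min l3) m => //= _.
  by constructor 2; apply: reg.
by constructor 3; apply: reg => // t; [move/K; rewrite addnC|move/O => []].
Qed.

(** At time [Num.max c 1] the hub is present and both bars are alive. The cut-off leg accounts for
    one class, which is split off; the subtree that remains is handled by [unimodal_rest]. *)
Lemma PH_legs_walled c l1 l2 l3 : c < 4 -> PH_legs c l1 l2 l3 ->
  leg_out l1 (Num.max c 1) (Num.max c 1) -> sym3 (bimodal c) l1 l2 l3.
Proof.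
move=> c4 H out1; set t0 := Num.max c 1 in out1.
have t04 : t0 < 4 by rewrite /t0; case: (leP c 1); lra.
have ct0 : c <= t0 by rewrite le_max lexx.
have t01 : 1 <= t0 by rewrite le_max lexx orbT.
have O4 := PH_out_ge4 H.
have b1t0 : l1.2 <= t0 by case/andP: out1.
have a1t0 : t0 < l1.1 by case/andP: out1 => _; rewrite -ltNge.
have Ht0 s t : t0 <= s -> s <= t -> t < 4 ->
    (leg_out l1 s t + leg_out l2 s t + leg_out l3 s t = 1)%N.
  move=> t0s st t4; have := H s t st; rewrite legs_rank_ge ?t4; last lra.
  have -> : c <= s by lra.
  have -> : 0 <= s by lra.
  have -> : 1 <= s by lra.
  by rewrite /=; b2n_lia.
have [out2 out3] : leg_out l2 t0 t0 = false /\ leg_out l3 t0 t0 = false.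
  have := Ht0 t0 t0 (lexx _) (lexx _) t04; rewrite out1.
  by case: (leg_out l2 _ _); case: (leg_out l3 _ _).
(* A near value below 4 would merge the second class too early, and one above 4 would keep it alive
   too long. *)
have a1 : l1.1 = 4.
  apply/eqP; rewrite eq_le; apply/andP; split.
    apply: not_leg_out; first lra.
    by have [] := O4 4 (lexx _).
  rewrite leNgt; apply/negP => a14.
  have := Ht0 t0 l1.1 (lexx _) (ltW a1t0) a14.
  have E l : leg_out l t0 t0 = false -> leg_out l t0 l1.1 = false.
    move=> o; apply/negP => /(leg_out_sub (lexx t0) (ltW a1t0)).
    by rewrite o.
  by rewrite (E _ out2) (E _ out3) /leg_out lexx andbF.
have l1E : l1 = (4, l1.2) by rewrite -a1 -surjective_pairing.
have i1 : walled_leg l1.2 l1 by [].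
have b14 : l1.2 <= 4 by lra.
(* Below time 4 the walled leg contributes exactly the class born at [l1.2], so the ranks add up. *)
have rest s t : s <= t -> t < 4 -> ((l1.2 <= s)%R + rest_rank c l2 l3 s t
    = (0 <= s)%R + (1 <= s)%R)%N.
  move=> st t4; have := H s t st; rewrite t4 andbT /rest_rank => <-.
  case: (leP c t) => ct.
    rewrite legs_rank_ge // (walled_out _ _ i1) (walled_in _ st i1) //.
    by rewrite [4 <= t]leNgt t4 andbT andbF /= -!addnA.
  by rewrite legs_rank_lt // (walled_min _ i1) // addnA.
have b1 : l1.2 <= 1.
  have := rest 1 t0 t01 t04; rewrite lexx ler01 /rest_rank ct0.
  have E l : leg_out l t0 t0 = false -> leg_out l 1 t0 = false.
    by move=> o; apply/negP => /(leg_out_sub t01 (lexx t0)); rewrite o.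
  by rewrite (E _ out2) (E _ out3); case: (_ <= 1) => //; case: [|| _, _ | _].
have b0 : 0 <= l1.2.
  rewrite leNgt; apply/negP => b0; have := rest l1.2 l1.2 (lexx _) ltac:(lra).
  rewrite lexx [0 <= _]leNgt b0 [1 <= _]leNgt (lt_trans b0) //.
(* If [l1.2] were strictly between 0 and 1, the rest would carry the class born at 0 and yet have
   rank 0 at time [l1.2]. *)
have b01 : l1.2 = 0 \/ l1.2 = 1.
  have [//|b1p] := eqVneq l1.2 0; first by left.
  right; apply/eqP; rewrite eq_le b1 /= leNgt; apply/negP => b1'.
  have {b1p b0} b0 : 0 < l1.2 by rewrite lt_neqAle eq_sym b1p.
  have := rest 0 0 (lexx _) ltac:(lra).
  rewrite lexx [l1.2 <= 0]leNgt b0 [1 <= 0]leNgt ltr01 /= add0n addn0.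
  have := rest l1.2 l1.2 (lexx _) ltac:(lra).
  rewrite lexx (ltW b0) [1 <= _]leNgt b1' /= addn0 => /eqP.
  rewrite -{2}[1%N]addn0 eqn_add2l /rest_rank => /eqP.
  have [cb|cb] := leP c l1.2; first by case: (leg_out _ _ _); case: (leg_out _ _ _).
  rewrite [c <= 0]leNgt (lt_trans b0 cb) /=.
  have E l : ((leg_min l <= 0)%R <= (leg_min l <= l1.2)%R)%N by apply: leq_b2n; lra.
  by have := E l2; have := E l3; b2n_lia.
have [b b1E] : exists b : bool, l1.2 = (~~ b)%:R.
  by case: b01 => ->; [exists true|exists false].
have {}i1 : walled_leg (~~ b)%:R l1 by rewrite -b1E.
have := @unimodal_rest b%:R c l2 l3.
case=> //.
- by case: {+}b => /=; lra.
- by move=> t /O4[].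
- by move=> t /O4[].
- move=> s t st t4; have := rest s t st t4; rewrite b1E.
  by case: {+}b => /=; b2n_lia.
- by case=> cE f2 f3; left; apply: (Bimodal_mid cE i1).
- by case=> bc r2 f3; left; apply: (Bimodal_side bc (ltW c4) i1).
- by case=> bc r2 f3; right; left; apply: (Bimodal_side bc (ltW c4) i1).
Qed.

(** For [c < 4] there are two classes at time [Num.max c 1]. One contains the hub, so some leg has a
    cut-off far vertex, and it is moved to the front. *)
Lemma PH_legs_bimodal c l1 l2 l3 : PH_legs c l1 l2 l3 -> sym3 (bimodal c) l1 l2 l3.
Proof.
move=> H; have := PH_hub_le4 H; rewrite le_eqVlt => /orP[/eqP c4|c4].
  by move: H; rewrite c4; exact: PH_legs_split.
set t0 := Num.max c 1.
have : [|| leg_out l1 t0 t0, leg_out l2 t0 t0 | leg_out l3 t0 t0].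
  have t04 : t0 < 4 by rewrite /t0; case: (leP c 1); lra.
  have ct0 : c <= t0 by rewrite le_max lexx.
  have t01 : 1 <= t0 by rewrite le_max lexx orbT.
  have := H t0 t0 (lexx _); rewrite legs_rank_ge // ct0 t01 t04.
  have -> : 0 <= t0 by lra.
  by case: (leg_out _ _ _); case: (leg_out _ _ _); case: (leg_out _ _ _).
case/or3P => o.
- exact: PH_legs_walled.
- by apply/sym3_swap12/PH_legs_walled => //; apply: PH_legs_swap12.
- apply/sym3_swap23/sym3_swap12/PH_legs_walled => //.
  exact/PH_legs_swap12/PH_legs_swap23.
Qed.

Lemma dataP_bimodal (z : 'rV[R]_7) :
  dataP z <-> sym3 (bimodal (hub z)) (leg1 z) (leg2 z) (leg3 z).
Proof.
rewrite dataP_legs; split; first exact: PH_legs_bimodal.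
apply: sym3_elim => *; [exact: PH_legs_swap12|exact: PH_legs_swap23|].
exact: bimodal_PH_legs.
Qed.

End Bimodal.

(** * The two-step deformation onto a polygon of configurations *)

Section Retraction.
Variable R : realType.
Implicit Types (l : R * R) (x y c m k e : R) (b : bool).

Lemma natr_bool01 b : 0 <= (b%:R : R) <= 1.
Proof. by case: b => /=; lra. Qed.

Definition lower x l := (l.1, l.2 + x * (leg_min l - l.2)).

(* [excess c l] is [l.1 - c] on a free leg with [l.1 = l.2], and vanishes on the
   regular and walled legs. *)
Definition excess c l := Num.max 0 (2 * l.2 - l.1 - c).
(** The target [Num.max l.1 c - excess c l] of the near value is [c] on regular and free legs with
    [l.2 <= l.1], and 4 on walled ones. A single formula for all leg types keeps the motion
    continuous where they meet. *)
Definition settle x c l :=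
  (l.1 + x * (Num.max l.1 c - excess c l - l.1), l.2 - x * excess c l).

Definition move_leg x y c l := settle y c (lower x l).

Lemma lower_regular x m c l : 0 <= x <= 1 -> regular_leg m c l -> regular_leg m c (lower x l).
Proof.
move=> /andP[x0 x1] [<- ac]; split=> //; rewrite /lower /leg_min /=.
have [ab|ba] := leP l.1 l.2; last by rewrite subrr mulr0 addr0 min_r // ltW.
rewrite min_l //; have : 0 <= (1 - x) * (l.2 - l.1) by apply: mulr_ge0; lra.
lra.
Qed.

Lemma lower_walled x m l : m <= 4 -> walled_leg m l -> walled_leg m (lower x l).
Proof.
by move=> m4 i; rewrite /lower (walled_min m4 i) i /= subrr mulr0 addr0.
Qed.

Lemma lower_free x c l : 0 <= x <= 1 -> free_leg c l -> free_leg c (lower x l).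
Proof.
move=> /andP[x0 x1] [ca ab]; split=> //=; rewrite /leg_min min_l //.
have : 0 <= (1 - x) * (l.2 - l.1) by apply: mulr_ge0; lra.
lra.
Qed.

Lemma lower1_flat l : (lower 1 l).2 <= (lower 1 l).1.
Proof. by rewrite /= mul1r addrC subrK ge_min lexx. Qed.

Lemma settle_regular y m c l : l.2 <= l.1 -> regular_leg m c l ->
  settle y c l = (l.1 + y * (c - l.1), m).
Proof.
move=> ba [mE ac]; have bm : l.2 = m by rewrite -mE /leg_min min_r.
rewrite /settle /excess (max_r ac) max_l ?mulr0 ?subr0 ?bm //; lra.
Qed.

Lemma settle_walled y m c l : m <= 1 -> 0 <= c <= 4 -> walled_leg m l ->
  settle y c l = l.
Proof.
move=> m1 /andP[c0 c4] ->; rewrite /settle /excess /= (max_l c4) max_l; last lra.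
by rewrite !subr0 subrr !mulr0 subr0 addr0.
Qed.

Lemma settle_free y c l : l.2 <= l.1 -> free_leg c l ->
  settle y c l = (l.1 + y * (c - l.1), l.1 + y * (c - l.1)).
Proof.
move=> ba [ca ab]; have bE : l.2 = l.1 by apply/eqP; rewrite eq_le ba.
rewrite /settle /excess bE (max_l ca) max_r; last lra.
by congr pair; ring.
Qed.

Lemma settle0 c l : settle 0 c l = l.
Proof. by rewrite /settle !mul0r addr0 subr0 -surjective_pairing. Qed.

Lemma lower0 l : lower 0 l = l.
Proof. by rewrite /lower mul0r addr0 -surjective_pairing. Qed.

Section Move.
Variables x y c : R.
Hypotheses (x01 : 0 <= x <= 1) (y01 : 0 <= y <= 1) (xy : x = 1 \/ y = 0).

(** Settling is controlled only on a leg already lowered, whence [x = 1 \/ y = 0]: the second phase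
    moves only while the first is complete. *)
Lemma move_regular m l : regular_leg m c l -> regular_leg m c (move_leg x y c l).
Proof.
move=> /(lower_regular x01) r; rewrite /move_leg; case: xy => [x1|->]; last first.
  by rewrite settle0.
rewrite x1 in r *; rewrite (settle_regular _ (lower1_flat l) r).
case: r => rm ra; have := lower1_flat l.
have ba : (lower 1 l).2 = m by rewrite -rm /leg_min min_r // lower1_flat.
rewrite ba => ma; case/andP: y01 => y0 y1.
have : 0 <= y * (c - (lower 1 l).1) by apply: mulr_ge0; lra.
have : 0 <= (1 - y) * (c - (lower 1 l).1) by apply: mulr_ge0; lra.
by split; rewrite /leg_min /= ?min_r; lra.
Qed.

Lemma move_walled m l : m <= 1 -> 0 <= c <= 4 -> walled_leg m l ->
  move_leg x y c l = (4, m).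
Proof.
move=> m1 c04 /(lower_walled x) i; rewrite /move_leg (settle_walled _ m1) //.
all: by apply: i; lra.
Qed.

Lemma move_free l : free_leg c l -> free_leg c (move_leg x y c l).
Proof.
move=> /(lower_free x01) r; rewrite /move_leg; case: xy => [x1|->]; last first.
  by rewrite settle0.
rewrite x1 in r *; rewrite (settle_free _ (lower1_flat l) r).
case: r => ca ab; case/andP: y01 => y0 y1.
have : 0 <= (1 - y) * ((lower 1 l).1 - c) by apply: mulr_ge0; lra.
by split=> //=; lra.
Qed.

Lemma move_bimodal l1 l2 l3 : bimodal c l1 l2 l3 ->
  bimodal c (move_leg x y c l1) (move_leg x y c l2) (move_leg x y c l3).
Proof.
case=> [cE r1 r2 f3|b bc c4 i1 r2 f3|b cE i1 f2 f3].
- by apply: Bimodal_split => //; [exact: move_regular|exact: move_regular|exact: move_free].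
- apply: (Bimodal_side bc c4); [|exact: move_regular|exact: move_free].
  have := natr_bool01 b; have := natr_bool01 (~~ b) => ? ?.
  by apply: move_walled => //; lra.
- apply: (Bimodal_mid cE); [|exact: move_free|exact: move_free].
  have := natr_bool01 b; have := natr_bool01 (~~ b) => ? ?.
  by apply: move_walled => //; lra.
Qed.

End Move.

Lemma move_leg0 c l : move_leg 0 0 c l = l.
Proof. by rewrite /move_leg settle0 lower0. Qed.

Definition retract_leg c l := move_leg 1 1 c l.

Lemma retract_regular m c l : regular_leg m c l -> retract_leg c l = (c, m).
Proof.
move=> r; rewrite /retract_leg /move_leg.
rewrite (settle_regular _ (lower1_flat l) (lower_regular _ r)); last lra.
by congr pair; ring.
Qed.

Lemma retract_free c l : free_leg c l -> retract_leg c l = (c, c).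
Proof.
move=> r; rewrite /retract_leg /move_leg.
rewrite (settle_free _ (lower1_flat l) (lower_free _ r)); last lra.
by congr pair; ring.
Qed.

(** Each choice of [b] and of an order of the legs gives one segment with parameter [c]: these are
    the twelve sides of the polygon. *)
Definition skeleton_at b c l1 l2 l3 :=
  [/\ b%:R <= c <= 4, l1 = (4, (~~ b)%:R), l2 = (c, b%:R) & l3 = (c, c)].
Definition skeleton c l1 l2 l3 := exists b, skeleton_at b c l1 l2 l3.

Lemma retract_bimodal c l1 l2 l3 : bimodal c l1 l2 l3 ->
  skeleton c (retract_leg c l1) (retract_leg c l2) (retract_leg c l3).
Proof.
case=> [cE r1 r2 f3|b bc c4 i1 r2 f3|b cE i1 f2 f3].
(* At [c = 4] the leg with minimum 0 retracts to [(4, 0)], which is a walled leg. *)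
- exists true; split; rewrite ?(retract_regular r1) ?(retract_regular r2) //.
  + by rewrite /= cE; lra.
  + by rewrite cE.
  + exact: retract_free.
- have := natr_bool01 b; have := natr_bool01 (~~ b) => ? ?.
  exists b; split; [lra| |exact: retract_regular|exact: retract_free].
  by apply: move_walled i1 => //; lra.
- have := natr_bool01 b; have := natr_bool01 (~~ b) => ? ?.
  (* Since [c = b], the retracted free leg [(c, c)] also reads as [(c, b)]. *)
  exists b; split; [lra| |rewrite -cE; exact: retract_free|exact: retract_free].
  by apply: move_walled i1 => //; lra.
Qed.

Lemma skeleton_bimodal c l1 l2 l3 : skeleton c l1 l2 l3 -> bimodal c l1 l2 l3.
Proof.
case=> b [/andP[bc c4] -> -> ->]; apply: (Bimodal_side bc c4) => //.
by split; rewrite ?lexx // /leg_min min_r.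
Qed.

Lemma retract_skeleton c l1 l2 l3 : skeleton c l1 l2 l3 ->
  [/\ retract_leg c l1 = l1, retract_leg c l2 = l2 & retract_leg c l3 = l3].
Proof.
case=> b [/andP[bc c4] -> -> ->].
have := natr_bool01 b; have := natr_bool01 (~~ b) => ? ?.
split; [by apply: move_walled => //; lra| |].
  by apply: retract_regular; split; rewrite ?lexx // /leg_min min_r.
by apply: retract_free; split => /=.
Qed.

End Retraction.

(** * Leg weights and radial projection onto the polygon *)

Section Polygon.
Variable R : realType.
Implicit Types (l : R * R) (x y z c m k e u : R) (b : bool).

(* Positive on a leg carrying the minimum 0, negative on one carrying the
   minimum 1, and zero on a leg with equal values. *)
Definition weight l := (l.1 - l.2) * (1 - 2 * l.2).

(** These are the weights of the legs [(4, 0)] or [(4, 1)], [(c, b)] and [(c, c)] of the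
    skeleton. *)
Definition polygon_at b c u1 u2 u3 :=
  [/\ b%:R <= c <= 4, u1 = (if b then 4 else -3), u2 = (if b then 1 - c else c) & u3 = 0].
Definition polygon u1 u2 u3 := exists b c, polygon_at b c u1 u2 u3.

Lemma weight_skeleton b c l1 l2 l3 : skeleton_at b c l1 l2 l3 ->
  polygon_at b c (weight l1) (weight l2) (weight l3).
Proof.
case=> bc -> -> ->; split; rewrite // /weight /=; last by ring.
all: by case: {+}b => /=; ring.
Qed.

Definition top3 x y z := Num.max x (Num.max y z).
Definition bot3 x y z := Num.min x (Num.min y z).
Definition med3 x y z := x + y + z - top3 x y z - bot3 x y z.

Lemma top3_swap12 x y z : top3 x y z = top3 y x z.
Proof. exact: maxCA. Qed.
Lemma top3_swap23 x y z : top3 x y z = top3 x z y.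
Proof. by rewrite /top3 [Num.max y z]maxC. Qed.
Lemma bot3_swap12 x y z : bot3 x y z = bot3 y x z.
Proof. exact: minCA. Qed.
Lemma bot3_swap23 x y z : bot3 x y z = bot3 x z y.
Proof. by rewrite /bot3 [Num.min y z]minC. Qed.
Lemma med3_swap12 x y z : med3 x y z = med3 y x z.
Proof. by rewrite /med3 (top3_swap12 x) (bot3_swap12 x) [x + y]addrC. Qed.
Lemma med3_swap23 x y z : med3 x y z = med3 x z y.
Proof. by rewrite /med3 (top3_swap23 x y) (bot3_swap23 x y) [x + y + z]addrAC. Qed.

Lemma sorted3 x y z : x <= y -> y <= z ->
  [/\ top3 x y z = z, bot3 x y z = x & med3 x y z = y].
Proof.
move=> xy yz; have xz := le_trans xy yz.
rewrite /med3 /top3 /bot3 (max_r yz) (max_r xz) (min_l yz) (min_l xy).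
by split=> //; ring.
Qed.

(** The spread of the weights is [4 - (1 - c)] or [c + 3], hence [c + 3] on every side of the
    polygon. *)
Definition unweight_hub u1 u2 u3 := top3 u1 u2 u3 - bot3 u1 u2 u3 - 3.
(* On the polygon, [- (4 / 3) * u] is 4 at the walled value [u = -3] and at most
   [c] at the other legs. *)
Definition unweight_leg c u :=
  let a := Num.max c (Num.max u (- (4 / 3) * u)) in (a, a - `|u|).

Lemma polygon_top_bot b c u1 u2 u3 : polygon_at b c u1 u2 u3 ->
  [/\ top3 u1 u2 u3 = (if b then 4 else c), bot3 u1 u2 u3 = (if b then 1 - c else -3)
    & med3 u1 u2 u3 = 0].
Proof.
case=> + -> -> ->; case: b => /= /andP[bc c4].
  rewrite med3_swap12 med3_swap23 top3_swap12 top3_swap23 bot3_swap12 bot3_swap23.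
  by apply: sorted3; lra.
rewrite med3_swap23 top3_swap23 bot3_swap23.
by apply: sorted3; lra.
Qed.

Lemma unweight_polygon b c u1 u2 u3 : polygon_at b c u1 u2 u3 ->
  unweight_hub u1 u2 u3 = c /\
  skeleton_at b c (unweight_leg c u1) (unweight_leg c u2) (unweight_leg c u3).
Proof.
move=> p; rewrite /unweight_hub; have [-> -> _] := polygon_top_bot p.
split; first by case: {+}b; ring.
case: p => /= bc -> -> ->; split => //; rewrite /unweight_leg.
all: move: bc; case: b => /= /andP[bc c4].
- by rewrite (@max_l _ _ 4) ?max_r ?ger0_norm ?subrr //; lra.
- rewrite (@max_r _ _ (-3)) ?max_r ?ler0_norm //; [congr pair|..]; lra.
- rewrite (@max_r _ _ (1 - c)) ?max_l ?ler0_norm //; [congr pair|..]; lra.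
- rewrite (@max_l _ _ c (- _ * c)) ?max_l ?ger0_norm //; [congr pair|..]; lra.
- by rewrite mulr0 normr0 !max_l ?subr0 //; lra.
- by rewrite mulr0 normr0 !max_l ?subr0 //; lra.
Qed.

Lemma weight_unweight b c u1 u2 u3 : polygon_at b c u1 u2 u3 ->
  [/\ weight (unweight_leg c u1) = u1, weight (unweight_leg c u2) = u2
    & weight (unweight_leg c u3) = u3].
Proof.
move=> p; have [_ /weight_skeleton[_ -> -> ->]] := unweight_polygon p.
by case: p => _ -> -> ->.
Qed.

Lemma unweight_skeleton b c l1 l2 l3 : skeleton_at b c l1 l2 l3 ->
  [/\ unweight_hub (weight l1) (weight l2) (weight l3) = c,
      unweight_leg c (weight l1) = l1, unweight_leg c (weight l2) = l2
    & unweight_leg c (weight l3) = l3].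
Proof.
by move=> s; have [-> [_ -> -> ->]] := unweight_polygon (weight_skeleton s); case: s.
Qed.

(** The gauge of the polygon modulo the diagonal: it equals 1 there, is invariant under common
    translations and scales with positive factors. Subtracting the median in [normal3] picks the
    representative whose middle weight is 0. *)
Definition scale3 x y z :=
  Num.max ((top3 x y z - med3 x y z) / 4) ((med3 x y z - bot3 x y z) / 3).
Definition normal3 x y z u := (u - med3 x y z) / scale3 x y z.

Lemma scale3_gt0 x y z : ~ (x = z /\ y = z) -> 0 < scale3 x y z.
Proof.
move=> ne; rewrite /scale3 lt_max.
have [//|h1] := ltP 0 ((top3 x y z - med3 x y z) / 4).
have [//|h2] := ltP 0 ((med3 x y z - bot3 x y z) / 3).
have tb : top3 x y z <= bot3 x y z by lra.
have L u v : u <= top3 x y z -> bot3 x y z <= v -> u <= v by lra.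
case: ne; split; apply/eqP; rewrite eq_le; apply/andP; split; apply: L.
all: by rewrite ?le_max ?ge_min lexx ?orbT.
Qed.

(** The larger quotient in the gauge tells whether the bottom coordinate becomes -3 or the top one
    becomes 4, that is, which leg is walled. *)
Lemma polygon_normal3 x y z : ~ (x = z /\ y = z) ->
  sym3 polygon (normal3 x y z x) (normal3 x y z y) (normal3 x y z z).
Proof.
move=> ne; have s0 := scale3_gt0 ne; pose t := scale3 x y z; pose m := med3 x y z.
(* Recording median and gauge keeps the function [normal3 x y z] fixed while the coordinates are
   sorted. *)
pose P u1 u2 u3 := med3 u1 u2 u3 = m /\ scale3 u1 u2 u3 = t.
apply: (@sym3_map _ _ (normal3 x y z)
  (fun u1 u2 u3 => polygon (normal3 x y z u1) (normal3 x y z u2) (normal3 x y z u3))) => //.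
apply: (@sorted_sym3 _ _ P _ id) => // [u v w|u v w|u v w [mE tE]/= uv vw].
- by rewrite /P /scale3 med3_swap12 top3_swap12 bot3_swap12.
- by rewrite /P /scale3 med3_swap23 top3_swap23 bot3_swap23.
have t0 : 0 < t := s0.
have [tp bt md] := sorted3 uv vw.
have N a : normal3 x y z a = (a - v) / t by rewrite /normal3 -/m -mE md.
move: tE; rewrite /scale3 tp bt md; have [le43 tE|/ltW le43 tE] := leP ((w - v) / 4) ((v - u) / 3).
- right; left; rewrite !N subrr mul0r; exists false, ((w - v) / t).
  split=> //=; last by apply: (mulIf (lt0r_neq0 t0)); rewrite divfK ?gt_eqF //; lra.
  by rewrite divr_ge0 ?ler_pdivrMr; lra.
- right; right; right; right; left; rewrite !N subrr mul0r.
  exists true, (1 - (u - v) / t); split=> //=; last first.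
  - by ring.
  - by apply: (mulIf (lt0r_neq0 t0)); rewrite divfK ?gt_eqF //; lra.
  have : 0 <= (v - u) / t by rewrite divr_ge0; lra.
  have : (v - u) / t <= 3 by rewrite ler_pdivrMr; lra.
  by rewrite -[u - v]opprB mulNr; lra.
Qed.

Lemma max_affine k e x y : 0 < k ->
  Num.max (k * x + e) (k * y + e) = k * Num.max x y + e.
Proof. by move=> k0; rewrite -addr_maxl maxr_pMr // ltW. Qed.

Lemma min_affine k e x y : 0 < k ->
  Num.min (k * x + e) (k * y + e) = k * Num.min x y + e.
Proof. by move=> k0; rewrite -addr_minl minr_pMr // ltW. Qed.

Lemma normal3_affine k e x y z u : 0 < k ->
  normal3 (k * x + e) (k * y + e) (k * z + e) (k * u + e) = normal3 x y z u.
Proof.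
move=> k0.
have tE : top3 (k * x + e) (k * y + e) (k * z + e) = k * top3 x y z + e.
  by rewrite /top3 !max_affine.
have bE : bot3 (k * x + e) (k * y + e) (k * z + e) = k * bot3 x y z + e.
  by rewrite /bot3 !min_affine.
have mE : med3 (k * x + e) (k * y + e) (k * z + e) = k * med3 x y z + e.
  by rewrite /med3 tE bE; ring.
rewrite /normal3 /scale3 tE bE mE.
have D v w : k * v + e - (k * w + e) = k * (v - w) by ring.
rewrite !D -!mulrA -maxr_pMr; last exact: ltW.
by rewrite invfM mulrCA mulVKf ?gt_eqF.
Qed.

Lemma normal3_polygon u1 u2 u3 : sym3 polygon u1 u2 u3 ->
  forall u, normal3 u1 u2 u3 u = u.
Proof.
apply: (@sym3_elim _ (fun u1 u2 u3 => forall u, normal3 u1 u2 u3 u = u)).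
- by move=> x y z H u; rewrite -[RHS]H /normal3 /scale3 med3_swap12 top3_swap12 bot3_swap12.
- by move=> x y z H u; rewrite -[RHS]H /normal3 /scale3 med3_swap23 top3_swap23 bot3_swap23.
move=> {u1 u2 u3} u1 u2 u3 [b [c p]] u; rewrite /normal3 /scale3.
have [-> -> ->] := polygon_top_bot p; case: p => + _ _ _.
rewrite subr0 => bc; rewrite (_ : Num.max _ _ = 1) ?divr1 //.
by case: b bc => /= bc; [rewrite max_l|rewrite max_r]; lra.
Qed.

End Polygon.

(** * Pointwise continuity of the maps built from arithmetic, maxima and minima *)

Definition cont_at (T : topologicalType) (R : realType) (t : T) (f : T -> R) :=
  {for t, continuous f}.

Section Continuity.
Variables (T : topologicalType) (R : realType) (t : T).
Implicit Types f g : T -> R.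

(** A neighbourhood of a row vector contains a finite product of neighbourhoods of its entries. *)
Lemma cont_rV n (F : T -> 'rV[R]_n) :
  (forall i, cont_at t (fun s => F s ord0 i)) -> {for t, continuous F}.
Proof.
move=> H A [P FP PA].
have : \forall s \near t, forall i, P ord0 i (F s ord0 i).
  by apply: filter_forall => i; apply: H; apply: FP.
by apply: filterS => s Ps; apply: PA => i j; rewrite ord1; exact: Ps.
Qed.

Lemma cont_ext f g : f =1 g -> cont_at t g -> cont_at t f.
Proof. by move=> /funext ->. Qed.

Lemma cont_cst (k : R) : cont_at t (fun=> k).
Proof. exact: cvg_cst. Qed.

Lemma cont_add f g : cont_at t f -> cont_at t g -> cont_at t (fun s => f s + g s).
Proof. exact: cvgD. Qed.

Lemma cont_opp f : cont_at t f -> cont_at t (fun s => - f s).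
Proof. exact: cvgN. Qed.

Lemma cont_mul f g : cont_at t f -> cont_at t g -> cont_at t (fun s => f s * g s).
Proof. exact: cvgM. Qed.

Lemma cont_inv f : f t != 0 -> cont_at t f -> cont_at t (fun s => (f s)^-1).
Proof. exact: cvgV. Qed.

Lemma cont_max f g :
  cont_at t f -> cont_at t g -> cont_at t (fun s => Num.max (f s) (g s)).
Proof. exact: continuous_max. Qed.

Lemma cont_min f g :
  cont_at t f -> cont_at t g -> cont_at t (fun s => Num.min (f s) (g s)).
Proof. exact: continuous_min. Qed.

Lemma cont_norm f : cont_at t f -> cont_at t (fun s => `|f s|).
Proof. exact: cvg_norm. Qed.

Lemma cont_sqrt f : cont_at t f -> cont_at t (fun s => Num.sqrt (f s)).
Proof. by move=> cf; apply: continuous_comp cf _; exact: sqrt_continuous. Qed.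

Definition cont_leg (l : T -> R * R) :=
  cont_at t (fun s => (l s).1) /\ cont_at t (fun s => (l s).2).

End Continuity.

Ltac cont :=
  lazymatch goal with
  | |- cont_at _ (fun _ => ?k) => exact: cont_cst
  | |- cont_at _ (fun s => @?f s + @?g s) => apply: (@cont_add _ _ _ f g); cont
  | |- cont_at _ (fun s => - @?f s) => apply: (@cont_opp _ _ _ f); cont
  | |- cont_at _ (fun s => @?f s * @?g s) => apply: (@cont_mul _ _ _ f g); cont
  | |- cont_at _ (fun s => Num.max (@?f s) (@?g s)) => apply: (@cont_max _ _ _ f g); cont
  | |- cont_at _ (fun s => Num.min (@?f s) (@?g s)) => apply: (@cont_min _ _ _ f g); cont
  | |- cont_at _ (fun s => `|@?f s|) => apply: (@cont_norm _ _ _ f); cont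
  | _ => assumption
  end.

Section ContinuousMaps.
Variables (T : topologicalType) (R : realType) (t : T).
Implicit Types (x y z u c : T -> R) (l : T -> R * R).

Lemma cont_move_leg x y c l :
  cont_at t x -> cont_at t y -> cont_at t c -> cont_leg t l ->
  cont_leg t (fun s => move_leg (x s) (y s) (c s) (l s)).
Proof.
move=> cx cy cc [cl1 cl2].
have [m1 m2] : cont_leg t (fun s => lower (x s) (l s)).
  by split; rewrite /lower /leg_min /=; cont.
by split; rewrite /move_leg /settle /excess; cbv beta iota delta [fst snd]; cont.
Qed.

Lemma cont_weight l : cont_leg t l -> cont_at t (fun s => weight (l s)).
Proof. by case=> cl1 cl2; rewrite /weight; cont. Qed.

Lemma cont_top3 x y z : cont_at t x -> cont_at t y -> cont_at t z ->
  cont_at t (fun s => top3 (x s) (y s) (z s)).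
Proof. by move=> cx cy cz; rewrite /top3; cont. Qed.

Lemma cont_bot3 x y z : cont_at t x -> cont_at t y -> cont_at t z ->
  cont_at t (fun s => bot3 (x s) (y s) (z s)).
Proof. by move=> cx cy cz; rewrite /bot3; cont. Qed.

Lemma cont_normal3 x y z u :
  cont_at t x -> cont_at t y -> cont_at t z -> cont_at t u ->
  scale3 (x t) (y t) (z t) != 0 ->
  cont_at t (fun s => normal3 (x s) (y s) (z s) (u s)).
Proof.
move=> cx cy cz cu s0; have ct := cont_top3 cx cy cz; have cb := cont_bot3 cx cy cz.
have cm : cont_at t (fun s => med3 (x s) (y s) (z s)) by rewrite /med3; cont.
have cs : cont_at t (fun s => scale3 (x s) (y s) (z s)) by rewrite /scale3; cont.
by rewrite /normal3; apply: cont_mul; [cont|exact: cont_inv].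
Qed.

Lemma cont_unweight_leg c u : cont_at t c -> cont_at t u ->
  cont_leg t (fun s => unweight_leg (c s) (u s)).
Proof. by move=> cc cu; split; rewrite /unweight_leg /=; cont. Qed.

End ContinuousMaps.

(** * The maps between the fibre and the circle, and their composites *)

Section Assembly.
Variable R : realType.
Implicit Types (z : 'rV[R]_7) (v : 'rV[R]_2) (l : R * R) (c x y k : R).

(** In vertex order the first leg is read from far to near, the other two from near to far. *)
Definition of_legs c l1 l2 l3 : 'rV[R]_7 :=
  \row_i nth 0 [:: l1.2; l1.1; c; l2.1; l2.2; l3.1; l3.2] i.

Lemma of_legsE c l1 l2 l3 :
  [/\ hub (of_legs c l1 l2 l3) = c, leg1 (of_legs c l1 l2 l3) = l1,
      leg2 (of_legs c l1 l2 l3) = l2 & leg3 (of_legs c l1 l2 l3) = l3].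
Proof.
by rewrite /hub /leg1 /leg2 /leg3 !mxE /= -!surjective_pairing.
Qed.

Lemma legsK z : of_legs (hub z) (leg1 z) (leg2 z) (leg3 z) = z.
Proof. by apply/rowP; apply: forall_vtx; rewrite mxE. Qed.

Lemma cont_of_legs (T : topologicalType) (t : T) (c : T -> R) (l1 l2 l3 : T -> R * R) :
  cont_at t c -> cont_leg t l1 -> cont_leg t l2 -> cont_leg t l3 ->
  {for t, continuous (fun s => of_legs (c s) (l1 s) (l2 s) (l3 s))}.
Proof.
move=> cc [? ?] [? ?] [? ?]; apply: cont_rV; apply: forall_vtx.
all: by apply: (cont_ext (fun s => mxE _ _ _ _)).
Qed.

Lemma cont_coord n (i : 'I_n) (w : 'rV[R]_n) :
  cont_at w (fun v : 'rV[R]_n => v ord0 i).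
Proof. exact: coord_continuous. Qed.

Definition move z x y := of_legs (hub z) (move_leg x y (hub z) (leg1 z))
  (move_leg x y (hub z) (leg2 z)) (move_leg x y (hub z) (leg3 z)).

Lemma dataP_of_legs c l1 l2 l3 :
  dataP (of_legs c l1 l2 l3) <-> sym3 (bimodal c) l1 l2 l3.
Proof. by rewrite dataP_bimodal; have [-> -> -> ->] := of_legsE c l1 l2 l3. Qed.

Lemma dataP_move z x y : 0 <= x <= 1 -> 0 <= y <= 1 -> x = 1 \/ y = 0 ->
  dataP z -> dataP (move z x y).
Proof.
move=> x01 y01 xy /dataP_bimodal dz; apply/dataP_of_legs.
by apply: sym3_map dz => l1 l2 l3; exact: move_bimodal.
Qed.

Lemma move0 z : move z 0 0 = z.
Proof. by rewrite /move !move_leg0 legsK. Qed.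

Lemma cont_move (T : topologicalType) (t : T) (z : T -> 'rV[R]_7) (x y : T -> R) :
  (forall i, cont_at t (fun s => z s ord0 i)) -> cont_at t x -> cont_at t y ->
  {for t, continuous (fun s => move (z s) (x s) (y s))}.
Proof.
move=> cz cx cy; apply: cont_of_legs; first exact: cz.
all: by apply: cont_move_leg => //; [exact: cz|split; exact: cz].
Qed.

Definition weight1 z := weight (retract_leg (hub z) (leg1 z)).
Definition weight2 z := weight (retract_leg (hub z) (leg2 z)).
Definition weight3 z := weight (retract_leg (hub z) (leg3 z)).

Definition mk2 x y : 'rV[R]_2 := \row_i nth 0 [:: x; y] i.
Definition norm2 x y := Num.sqrt (x ^+ 2 + y ^+ 2).

(** Differences with the third weight are coordinates modulo the diagonal; [from_circle] uses the
    representative with third coordinate 0. *)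
Definition to_circle z : 'rV[R]_2 :=
  let x := weight1 z - weight3 z in let y := weight2 z - weight3 z in
  mk2 (x / norm2 x y) (y / norm2 x y).

Definition from_circle v : 'rV[R]_7 :=
  let N := normal3 (v ord0 0) (v ord0 1) 0 in
  let u1 := N (v ord0 0) in let u2 := N (v ord0 1) in let u3 := N 0 in
  let c := unweight_hub u1 u2 u3 in
  of_legs c (unweight_leg c u1) (unweight_leg c u2) (unweight_leg c u3).

Lemma norm2_gt0 x y : ~ (x = 0 /\ y = 0) -> 0 < norm2 x y.
Proof.
move=> ne; rewrite sqrtr_gt0 lt_neqAle addr_ge0 ?sqr_ge0 // andbT eq_sym.
rewrite paddr_eq0 ?sqr_ge0 // !sqrf_eq0.
by apply/negP => /andP[/eqP ? /eqP ?]; apply: ne.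
Qed.

Lemma weights_polygon z : dataP z ->
  sym3 (@polygon R) (weight1 z) (weight2 z) (weight3 z).
Proof.
move=> /dataP_bimodal; apply: (sym3_map (h := fun l => weight (retract_leg (hub z) l))).
move=> l1 l2 l3 /retract_bimodal[b s]; exists b, (hub z); exact: weight_skeleton.
Qed.

Lemma polygon_neq (u1 u2 u3 : R) : sym3 (@polygon R) u1 u2 u3 ->
  ~ (u1 - u3 = 0 /\ u2 - u3 = 0).
Proof.
apply: (@sym3_elim _ (fun u1 u2 u3 => ~ (u1 - u3 = 0 /\ u2 - u3 = 0))).
- by move=> x y k H [xk yk]; apply: H; lra.
- by move=> x y k H [xk yk]; apply: H; lra.
by move=> x y k [b [c [_ -> _ ->]]] []; case: b; lra.
Qed.

Lemma circle_to_circle z : dataP z -> circle (to_circle z).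
Proof.
move=> /weights_polygon /polygon_neq; rewrite /to_circle /circle /= !mxE /=.
move: (weight1 z - _) (weight2 z - _) => x y /norm2_gt0 n0.
rewrite !expr_div_n -mulrDl -[X in X / _]sqr_sqrtr ?addr_ge0 ?sqr_ge0 //.
by rewrite divff // expf_neq0 // gt_eqF.
Qed.

Lemma unweight_sym3 (u1 u2 u3 : R) : sym3 (@polygon R) u1 u2 u3 ->
  let c := unweight_hub u1 u2 u3 in
  let fixed u := weight (retract_leg c (unweight_leg c u)) = u in
  [/\ sym3 (skeleton c) (unweight_leg c u1) (unweight_leg c u2) (unweight_leg c u3),
      fixed u1, fixed u2 & fixed u3].
Proof.
apply: (@sym3_elim _ (fun u1 u2 u3 => let c := unweight_hub u1 u2 u3 in
  let fixed u := weight (retract_leg c (unweight_leg c u)) = u in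
  [/\ sym3 (skeleton c) (unweight_leg c u1) (unweight_leg c u2) (unweight_leg c u3),
      fixed u1, fixed u2 & fixed u3])) => /=.
- move=> x y k; rewrite /unweight_hub (top3_swap12 y) (bot3_swap12 y).
  by case=> s *; split=> //; exact: sym3_swap12.
- move=> x y k; rewrite /unweight_hub (top3_swap23 x k) (bot3_swap23 x k).
  by case=> s *; split=> //; exact: sym3_swap23.
move=> {u1 u2 u3} u1 u2 u3 [b [c p]]; have [-> s] := unweight_polygon p.
have [w1 w2 w3] := weight_unweight p.
have [-> -> ->] := retract_skeleton (ex_intro _ b s).
by split=> //; left; exists b.
Qed.

Lemma circle_neq v : circle v -> ~ (v ord0 0 = 0 /\ v ord0 1 = 0).
Proof. by rewrite /circle /= => cv [x0 y0]; move: cv; rewrite x0 y0; lra. Qed.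

Lemma dataP_from_circle v : circle v -> dataP (from_circle v).
Proof.
move=> /circle_neq /polygon_normal3 /unweight_sym3[s _ _ _]; apply/dataP_of_legs.
by apply: (sym3_map (h := id)) s => l1 l2 l3; exact: skeleton_bimodal.
Qed.

(** The recovered weight differences are a positive multiple of the unit vector [v], so normalising
    them returns [v]. *)
Lemma from_circleK v : circle v -> to_circle (from_circle v) = v.
Proof.
move=> cv; have ne := circle_neq cv; have s0 := scale3_gt0 ne.
have /unweight_sym3[_ w1 w2 w3] := polygon_normal3 ne.
rewrite /to_circle /weight1 /weight2 /weight3 /from_circle.
set c := unweight_hub _ _ _ in w1 w2 w3 *.
have [-> -> -> ->] := of_legsE c (unweight_leg c (normal3 (v ord0 0) (v ord0 1) 0 (v ord0 0)))
  (unweight_leg c (normal3 (v ord0 0) (v ord0 1) 0 (v ord0 1)))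
  (unweight_leg c (normal3 (v ord0 0) (v ord0 1) 0 0)).
set k := (scale3 (v ord0 0) (v ord0 1) 0)^-1.
have D a : normal3 (v ord0 0) (v ord0 1) 0 a - normal3 (v ord0 0) (v ord0 1) 0 0 = a * k.
  by rewrite /normal3 -/k; ring.
rewrite w1 w2 w3 !D; have k0 : 0 < k by rewrite invr_gt0.
have -> : norm2 (v ord0 0 * k) (v ord0 1 * k) = k.
  by rewrite /norm2 !exprMn -mulrDl cv mul1r sqrtr_sqr gtr0_norm.
apply/rowP => i; rewrite mxE !mulfK ?gt_eqF //.
by case: i => [[|[|//]] Hi] /=; congr (v _ _); apply/val_inj.
Qed.

(** This composite is the retraction: the weights of the retracted legs survive normalisation, and
    on the skeleton they determine the hub and the legs. *)
Lemma to_circleK z : dataP z -> from_circle (to_circle z) = move z 1 1.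
Proof.
move=> dz; have p := weights_polygon dz; have := norm2_gt0 (polygon_neq p).
rewrite /from_circle /to_circle !mxE /=; set n := norm2 _ _ => n0.
(* The arguments are the images of the weights under one increasing affine map, which [normal3]
   ignores. *)
have N u : normal3 ((weight1 z - weight3 z) / n) ((weight2 z - weight3 z) / n) 0
    ((u - weight3 z) / n) = u.
  have E a : (a - weight3 z) / n = n^-1 * a + - (weight3 z / n) by ring.
  rewrite -[0 as X in normal3 _ _ X](mul0r n^-1) -(subrr (weight3 z)) !E.
  by rewrite normal3_affine ?invr_gt0 // normal3_polygon.
have N3 := N (weight3 z); rewrite subrr mul0r in N3.
rewrite !N N3 /move /weight1 /weight2 /weight3.
have : sym3 (skeleton (hub z)) (retract_leg (hub z) (leg1 z))
    (retract_leg (hub z) (leg2 z)) (retract_leg (hub z) (leg3 z)).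
  by move/dataP_bimodal: dz; apply: sym3_map => l1 l2 l3; exact: retract_bimodal.
rewrite -!/(retract_leg _ _).
move: (retract_leg _ (leg1 z)) (retract_leg _ (leg2 z)) (retract_leg _ (leg3 z)).
move: (hub z) => c l1 l2 l3.
pose ok l := unweight_leg c (weight l) = l.
suff H : sym3 (skeleton c) l1 l2 l3 ->
  [/\ unweight_hub (weight l1) (weight l2) (weight l3) = c, ok l1, ok l2 & ok l3].
  by case/H => -> -> -> ->.
apply: (@sym3_elim _ (fun l1 l2 l3 =>
  [/\ unweight_hub (weight l1) (weight l2) (weight l3) = c, ok l1, ok l2 & ok l3])).
- move=> k1 k2 k3; rewrite /unweight_hub (top3_swap12 (weight k1)) (bot3_swap12 (weight k1)).
  by case.
- move=> k1 k2 k3; rewrite /unweight_hub (top3_swap23 _ (weight k2)) (bot3_swap23 _ (weight k2)).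
  by case.
by move=> k1 k2 k3 [b]; exact: unweight_skeleton.
Qed.

Lemma cont_to_circle z : dataP z -> {for z, continuous to_circle}.
Proof.
move=> dz; have n0 := norm2_gt0 (polygon_neq (weights_polygon dz)).
have cc i := @cont_coord 7 i z.
have cw (l : 'rV[R]_7 -> R * R) : cont_leg z l ->
    cont_at z (fun s => weight (retract_leg (hub s) (l s))).
  move=> cl; apply: cont_weight; apply: cont_move_leg => //; try exact: cont_cst.
  exact: cc.
have c1 : cont_at z weight1 by apply: cw; split; exact: cc.
have c2 : cont_at z weight2 by apply: cw; split; exact: cc.
have c3 : cont_at z weight3 by apply: cw; split; exact: cc.
have c13 : cont_at z (fun s => weight1 s - weight3 s) by cont.
have c23 : cont_at z (fun s => weight2 s - weight3 s) by cont.
have cn : cont_at z (fun s => (norm2 (weight1 s - weight3 s) (weight2 s - weight3 s))^-1).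
  apply: cont_inv; first by rewrite gt_eqF.
  by rewrite /norm2; apply: cont_sqrt; apply: cont_add; apply: cont_mul.
apply: cont_rV => -[[|[|//]] Hi]; apply: (cont_ext (fun s => mxE _ _ _ _)) => /=;
  exact: cont_mul.
Qed.

Lemma cont_from_circle v : circle v -> {for v, continuous from_circle}.
Proof.
move=> /circle_neq/scale3_gt0/lt0r_neq0 s0.
have c0 := @cont_coord 2 0 v; have c1 := @cont_coord 2 1 v.
have cz : cont_at v (fun=> 0 : R) by exact: cont_cst.
have n1 := cont_normal3 c0 c1 cz c0 s0.
have n2 := cont_normal3 c0 c1 cz c1 s0.
have n3 := cont_normal3 c0 c1 cz cz s0.
have ct := cont_top3 n1 n2 n3; have cb := cont_bot3 n1 n2 n3.
have ch : cont_at v (fun s => let N := normal3 (s ord0 0) (s ord0 1) 0 in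
    unweight_hub (N (s ord0 0)) (N (s ord0 1)) (N 0)).
  by rewrite /unweight_hub /=; cont.
by apply: cont_of_legs => //; exact: cont_unweight_leg.
Qed.

End Assembly.

Theorem theorem7p5 (R : realType) :
  @homotopy_equivalent 'rV[R]_7 'rV[R]_2 R (@dataP R) (@circle R).
Proof.
exists (@to_circle R), (@from_circle R); split.
- split; apply: continuous_in_subspaceT => t /set_mem.
    exact: cont_to_circle.
  exact: cont_from_circle.
- exact: circle_to_circle.
- exact: dataP_from_circle.
(* In the first half of the time [x] stays 1 while [y] falls from 1 to 0; in the second half [y]
   stays 0 while [x] falls to 0. The homotopy thus runs the deformation backwards, from the
   retraction to the identity. *)
- exists (fun p => move p.1 (Num.min 1 (2 - 2 * p.2)) (Num.max 0 (1 - 2 * p.2))).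
  split; [|split; [|split]].
  + apply: continuous_subspaceT => p.
    have cs : cont_at p snd by exact: cvg_snd.
    apply: cont_move; [move=> i|cont|cont].
    by apply: (@continuous_comp _ _ _ fst (fun z : 'rV_7 => z ord0 i));
      [exact: cvg_fst|exact: cont_coord].
  + move=> z dz s /= s01; apply: dataP_move => //.
    * by case: (leP 1 (2 - 2 * s)); lra.
    * by case: (leP 0 (1 - 2 * s)); lra.
    * by case: (leP 1 (2 - 2 * s)) => ?; [left|right; rewrite max_l; lra].
  + move=> z dz /=; rewrite to_circleK // mulr0 !subr0 min_l ?max_r //; lra.
  + by move=> z dz /=; rewrite min_r ?max_l; [rewrite mulr1 subrr move0|lra|lra].
(* On the circle the composite is already the identity, so a constant homotopy suffices. *)
- exists (fun p => p.1); split; [|split; [|split]] => //.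
  + by apply: continuous_subspaceT => p; exact: cvg_fst.
  + by move=> v cv /=; rewrite from_circleK.
Qed.
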